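(* Let $\mathcal{M}'_b: z(u,v)=f(u)\,l(v)+g(u)\,e_4$, $u\in I$, $v\in J$, be a meridian surface of type $\mathcal{M}'_b$ in $\mathbb{E}^4_2$ (so $l$ is a unit-speed timelike curve on $\mathbb{S}^2_1(1)$ and $f'^2-g'^2=1$, $g'>0$). Then $\mathcal{M}'_b$ is quasi-minimal if and only if the curve $l$ has constant spherical curvature $\kappa=a=\mathrm{const}$, $a\neq0$, and the meridian curve $u\mapsto(f(u),g(u))$ is determined by $f'=\varphi(f)$, where $$\varphi(t)=\pm\frac1t\sqrt{(c\pm at)^2+t^2},\qquad c=\mathrm{const},$$ for some real constant $c$ and some fixed choice of the two signs, and $g$ is defined by $g'=\sqrt{f'^2-1}$.
   Context: $\mathbb{E}^4_2$ is $\mathbb{R}^4$ with the inner product $\langle x,y\rangle=x_1y_1+x_2y_2-x_3y_3-x_4y_4$ and standard basis $e_1,e_2,e_3,e_4$. Let $\mathbb{E}^3_1=\mathrm{span}\{e_1,e_2,e_3\}$ and $\mathbb{S}^2_1(1)=\{V\in\mathbb{E}^3_1:\langle V,V\rangle=1\}$. Meridian surface of type $\mathcal{M}'_b$: let $I,J\subset\mathbb{R}$ be open intervals, $f,g:I\to\mathbb{R}$ smooth with $f$ nowhere zero, $f'^2-g'^2=1$ and $g'>0$ (so $f'^2>1$); let $l:J\to\mathbb{S}^2_1(1)$ be a smooth curve with $\langle l',l'\rangle=-1$. The surface is $z(u,v)=f(u)l(v)+g(u)e_4$. Its induced metric is Lorentzian, with orthonormal tangent frame $X=z_u$, $Y=z_v/f=l'$,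 $\langle X,X\rangle=1$, $\langle Y,Y\rangle=-1$. Spherical curvature: put $t=l'$ and let $n$ be a smooth vector field along $l$ (unique up to sign) such that $\{l,t,n\}$ is an orthonormal frame of $\mathbb{E}^3_1$ with $\langle n,n\rangle=1$; then $\kappa(v)=\langle t'(v),n(v)\rangle$, so that $t'=\kappa n+l$, $n'=\kappa t$. For a Lorentz surface with second fundamental form $h$, the mean curvature vector field is $H=\tfrac12\,\mathrm{tr}\,h=\tfrac12\left(h(E_1,E_1)-h(E_2,E_2)\right)$ for any local orthonormal tangent frame with $\langle E_1,E_1\rangle=1$, $\langle E_2,E_2\rangle=-1$. The surface is quasi-minimal if $H$ is lightlike at each point, i.e. $H\neq0$ and $\langle H,H\rangle=0$ everywhere. ''$f'=\varphi(f)$'' means $f'(u)=\varphi(f(u))$ for all $u\in I$. *)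

(* Defs.v *)
From mathcomp Require Import all_boot all_order all_algebra.
From mathcomp Require Import all_classical all_reals all_analysis.
From mathcomp Require Import ring.

Set Implicit Arguments.
Unset Strict Implicit.
Unset Printing Implicit Defensive.

Import Order.TTheory GRing.Theory Num.Theory.
Import numFieldNormedType.Exports.

Local Open Scope classical_set_scope.
Local Open Scope ring_scope.

Definition open_interval (R : realType) (I : set R) : Prop :=
  [/\ open I, is_interval I & I !=set0].

Definition smooth_on (R : realType) (V : normedModType R) (I : set R)
    (h : R -> V) : Prop :=
  forall (n : nat) (x : R), I x -> derivable (derive1n n h) x 1.

(* Coordinates are indexed from 0, by numerals read in the ring 'I_4. *)
Definition dot (R : realType) (x y : 'rV[R]_4) : R :=
  x 0 0 * y 0 0 + x 0 1 * y 0 1 - x 0 2 * y 0 2 - x 0 3 * y 0 3.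

Definition std (R : realType) (i : 'I_4) : 'rV[R]_4 := delta_mx 0 i.

Definition E31 (R : realType) : set 'rV[R]_4 :=
  [set x | exists a b c : R,
     x = a *: std R 0 + b *: std R 1 + c *: std R 2].

Definition S21 (R : realType) : set 'rV[R]_4 :=
  [set x | E31 x /\ dot x x = 1].

Section Surface.
Variables (R : realType) (z : R -> R -> 'rV[R]_4).
Implicit Types (u v : R) (A B : R * R) (w : 'rV[R]_4).

Definition z_u u v : 'rV[R]_4 := derive1 (fun s => z s v) u.
Definition z_v u v : 'rV[R]_4 := derive1 (fun s => z u s) v.
Definition z_uu u v : 'rV[R]_4 := derive1 (fun s => z_u s v) u.
Definition z_uv u v : 'rV[R]_4 := derive1 (fun s => z_u u s) v.
Definition z_vv u v : 'rV[R]_4 := derive1 (fun s => z_v u s) v.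

(* A tangent vector is given by its coordinates in the basis (z_u, z_v). *)
Definition tangent u v A : 'rV[R]_4 := A.1 *: z_u u v + A.2 *: z_v u v.

Definition gram_det u v : R :=
  dot (z_u u v) (z_u u v) * dot (z_v u v) (z_v u v)
  - dot (z_u u v) (z_v u v) ^+ 2.

(* The orthogonal projection onto the normal plane, as characterized by
   [normal_part_orth] and [normal_part_tangent] when the induced metric is
   nondegenerate. *)
Definition normal_part u v w : 'rV[R]_4 :=
  w - tangent u v
    ((dot (z_v u v) (z_v u v) * dot w (z_u u v)
       - dot (z_u u v) (z_v u v) * dot w (z_v u v)) / gram_det u v,
     (dot (z_u u v) (z_u u v) * dot w (z_v u v)
       - dot (z_u u v) (z_v u v) * dot w (z_u u v)) / gram_det u v).

Definition second_ff u v A B : 'rV[R]_4 :=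
  normal_part u v
    ((A.1 * B.1) *: z_uu u v + (A.1 * B.2 + A.2 * B.1) *: z_uv u v
     + (A.2 * B.2) *: z_vv u v).

Definition lorentz_frame u v A B : Prop :=
  [/\ dot (tangent u v A) (tangent u v A) = 1,
      dot (tangent u v B) (tangent u v B) = -1
    & dot (tangent u v A) (tangent u v B) = 0].

(* An orthonormal frame exists only where the induced metric is Lorentzian; by
   [mean_curvature_unique] the value does not depend on its choice. *)
Definition is_mean_curvature u v (H : 'rV[R]_4) : Prop :=
  exists A B, lorentz_frame u v A B /\
    H = 2^-1 *: (second_ff u v A A - second_ff u v B B).

Definition quasi_minimal (I J : set R) : Prop :=
  forall u v, I u -> J v ->
    exists H, [/\ is_mean_curvature u v H, H != 0 & dot H H = 0].

Lemma normal_part_tangent u v w :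
  exists A, w - normal_part u v w = tangent u v A.
Proof. by eexists; rewrite /normal_part opprB addrC subrK. Qed.

Lemma normal_part_orth u v w A : gram_det u v != 0 ->
  dot (normal_part u v w) (tangent u v A) = 0.
Proof.
rewrite /normal_part /tangent /gram_det /=.
move: (z_u u v) (z_v u v) => x y D0.
have dotE (p q : R) :
    dot (w - (p *: x + q *: y)) (A.1 *: x + A.2 *: y) =
    A.1 * (dot w x - p * dot x x - q * dot x y)
    + A.2 * (dot w y - p * dot x y - q * dot y y).
  by rewrite /dot !mxE; ring.
rewrite dotE; move: D0.
move: (dot x x) (dot x y) (dot y y) (dot w x) (dot w y) => a b c d e D0.
by field.
Qed.

Lemma mean_curvature_unique u v H H' :
  is_mean_curvature u v H -> is_mean_curvature u v H' -> H = H'.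
Proof.
have trace A B : lorentz_frame u v A B -> gram_det u v != 0 /\
    second_ff u v A A - second_ff u v B B =
    (gram_det u v)^-1 *: normal_part u v
      (dot (z_v u v) (z_v u v) *: z_uu u v
       - (2 * dot (z_u u v) (z_v u v)) *: z_uv u v
       + dot (z_u u v) (z_u u v) *: z_vv u v).
  rewrite /lorentz_frame /second_ff /normal_part /tangent /gram_det.
  move: (z_u u v) (z_v u v) (z_uu u v) (z_uv u v) (z_vv u v) => x y r s t.
  have dotE (C D : R * R) :
      dot (C.1 *: x + C.2 *: y) (D.1 *: x + D.2 *: y) =
      C.1 * D.1 * dot x x + (C.1 * D.2 + C.2 * D.1) * dot x y
      + C.2 * D.2 * dot y y.
    by rewrite /dot !mxE; ring.
  have dotL (p q m : R) w :
      dot (p *: r + q *: s + m *: t) w =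
      p * dot r w + q * dot s w + m * dot t w.
    by rewrite /dot !mxE; ring.
  have dotLN (p q m : R) w :
      dot (p *: r - q *: s + m *: t) w =
      p * dot r w - q * dot s w + m * dot t w.
    by rewrite /dot !mxE; ring.
  rewrite !dotE !dotL !dotLN.
  case: A B => [a b] [c d] /=.
  move: (dot x x) (dot x y) (dot y y) (dot r x) (dot r y) (dot s x) (dot s y)
    (dot t x) (dot t y) => E F G rx ry sx sy tx ty [hA hB hAB].
  have hD : (E * G - F ^+ 2) * (a * d - b * c) ^+ 2 = -1.
    transitivity (
      (a * a * E + (a * b + b * a) * F + b * b * G)
      * (c * c * E + (c * d + d * c) * F + d * d * G)
      - (a * c * E + (a * d + b * c) * F + b * d * G) ^+ 2);
      first by ring.
    by rewrite hA hB hAB; ring.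
  have D0 : E * G - F ^+ 2 != 0.
    by apply/eqP => D0; move/eqP: hD; rewrite D0 mul0r eq_sym oppr_eq0 oner_eq0.
  split=> //.
  have e1 : a * a - c * c = G / (E * G - F ^+ 2).
    apply: (mulIf D0); rewrite divfK // -[RHS]mulr1 -[X in _ = _ * X]opprK -hD.
    apply/eqP; rewrite -subr_eq0; apply/eqP.
    transitivity ((E * G - F ^+ 2) *
      ((a * a) * ((c * c * E + (c * d + d * c) * F + d * d * G) + 1)
       + (c * c) * ((a * a * E + (a * b + b * a) * F + b * b * G) - 1)
       - (2 * a * c) * (a * c * E + (a * d + b * c) * F + b * d * G))).
      by ring.
    by rewrite hA hB hAB; ring.
  have e2 : b * b - d * d = E / (E * G - F ^+ 2).
    apply: (mulIf D0); rewrite divfK // -[RHS]mulr1 -[X in _ = _ * X]opprK -hD.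
    apply/eqP; rewrite -subr_eq0; apply/eqP.
    transitivity ((E * G - F ^+ 2) *
      ((b * b) * ((c * c * E + (c * d + d * c) * F + d * d * G) + 1)
       + (d * d) * ((a * a * E + (a * b + b * a) * F + b * b * G) - 1)
       - (2 * b * d) * (a * c * E + (a * d + b * c) * F + b * d * G))).
      by ring.
    by rewrite hA hB hAB; ring.
  have e3 : a * b - c * d = - F / (E * G - F ^+ 2).
    apply: (mulIf D0); rewrite divfK // -[RHS]mulr1 -[X in _ = _ * X]opprK -hD.
    apply/eqP; rewrite -subr_eq0; apply/eqP.
    transitivity ((E * G - F ^+ 2) *
      ((a * b) * ((c * c * E + (c * d + d * c) * F + d * d * G) + 1)
       + (c * d) * ((a * a * E + (a * b + b * a) * F + b * b * G) - 1)
       - (a * d + b * c) * (a * c * E + (a * d + b * c) * F + b * d * G))).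
      by ring.
    by rewrite hA hB hAB; ring.
  have e1' : a * a = G / (E * G - F ^+ 2) + c * c by rewrite -e1 subrK.
  have e2' : b * b = E / (E * G - F ^+ 2) + d * d by rewrite -e2 subrK.
  have e3' : a * b = - F / (E * G - F ^+ 2) + c * d by rewrite -e3 subrK.
  rewrite [b * a]mulrC [d * c]mulrC e1' e2' e3'.
  apply/rowP => i; rewrite !mxE.
  by field.
by move=> [A [B [/trace[_ e] ->]]] [A' [B' [/trace[_ e'] ->]]]; rewrite e e'.
Qed.

End Surface.

Definition meridian_surface (R : realType) (f g : R -> R)
    (l : R -> 'rV[R]_4) (u v : R) : 'rV[R]_4 :=
  f u *: l v + g u *: std R 3.

Definition meridian_data_Mb (R : realType) (I J : set R) (f g : R -> R)
    (l : R -> 'rV[R]_4) : Prop :=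
  [/\ open_interval I /\ open_interval J,
      smooth_on I f /\ smooth_on I g,
      forall u, I u ->
        [/\ f u != 0, derive1 f u ^+ 2 - derive1 g u ^+ 2 = 1
          & 0 < derive1 g u],
      smooth_on J l
    & forall v, J v -> S21 (l v) /\ dot (derive1 l v) (derive1 l v) = -1].

(* [n] completes l and t = l' to an orthonormal frame of E31; such an [n]
   exists and is unique up to sign. *)
Definition frame_normal (R : realType) (J : set R) (l n : R -> 'rV[R]_4) :
    Prop :=
  smooth_on J n /\
  forall v, J v ->
    [/\ E31 (n v), dot (n v) (n v) = 1, dot (l v) (n v) = 0
      & dot (derive1 l v) (n v) = 0].

Definition spherical_curvature (R : realType) (l n : R -> 'rV[R]_4) (v : R)
    : R :=
  dot (derive1n 2 l v) (n v).

(* s1 and s2 are the signs outside and inside the square root. *)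
Definition phi (R : realType) (s1 s2 : bool) (a c t : R) : R :=
  (-1) ^+ s1 * (t^-1 * Num.sqrt ((c + (-1) ^+ s2 * (a * t)) ^+ 2 + t ^+ 2)).

(* Main.v *)
(** Let [N = g' l + f' e_4] be the timelike unit normal.  In the frame
    [X = z_u], [Y = l'] one finds
    [2 H = (f'' / g' + g' / f) N - (kappa / f) n], so the surface is
    quasi-minimal iff [kappa v <> 0] and
    [kappa v ^ 2 = ((f f'' + g' ^ 2) / g') ^ 2] for all [u], [v].  The variables
    separate; by connectedness [kappa] is a constant [a <> 0] and
    [(f f'' + g' ^ 2) / g'] a constant [b = +/- a].  Since [f' f'' = g' g''],
    [(f g')' = f' (f f'' + g' ^ 2) / g'], and the latter condition is
    integrated to [f g' = c + b f]; then [f' ^ 2 = 1 + g' ^ 2] gives the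
    formula for [f']. *)
Require Import Defs.
From mathcomp Require Import all_boot all_order all_algebra.
From mathcomp Require Import all_classical all_reals all_analysis.
From mathcomp Require Import ring lra.
Import Order.TTheory GRing.Theory Num.Theory.
Import numFieldNormedType.Exports.
Local Open Scope classical_set_scope.
Local Open Scope ring_scope.

Set Implicit Arguments.
Unset Strict Implicit.
Unset Printing Implicit Defensive.

(** * Calculus on an interval *)

Lemma is_derive_mx (R : realType) (V : normedModType R) (m k : nat)
    (M : V -> 'M[R]_(m, k)) (dM : 'M[R]_(m, k)) (t v : V) :
  is_derive t v M dM <->
  forall i j, is_derive t v (fun x => M x i j) (dM i j).
Proof.
split=> [[Md <-] i j|Md].
  by rewrite derive_mx // mxE; apply/derivableP; exact: (derivable_mxP M t v).1.
have M' : derivable M t v by apply/derivable_mxP => i j; case: (Md i j).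
apply: DeriveDef => //; rewrite derive_mx //; apply/matrixP => i j.
by rewrite mxE; apply: derive_val.
Qed.

Lemma is_derive_scale_mx (R : realType) (m k : nat) (p : R -> R)
    (M : R -> 'M[R]_(m, k)) (dp x : R) (dM : 'M[R]_(m, k)) :
  is_derive x 1 p dp -> is_derive x 1 M dM ->
  is_derive x 1 (fun s => p s *: M s) (dp *: M x + p x *: dM).
Proof.
move=> hp /is_derive_mx hM; apply/is_derive_mx => i j.
rewrite !mxE (_ : (fun s => _) = p * (fun s => M s i j)); last first.
  by apply/funext => s; rewrite mxE.
apply: is_derive_eq (is_deriveM hp (hM i j)) _.
by rewrite /GRing.scale /= [RHS]addrC [_ * dp]mulrC.
Qed.

Lemma is_derive_dot (R : realType) (F G : R -> 'rV[R]_4) (dF dG : 'rV[R]_4)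
    (x : R) :
  is_derive x 1 F dF -> is_derive x 1 G dG ->
  is_derive x 1 (fun s => dot (F s) (G s)) (dot dF (G x) + dot (F x) dG).
Proof.
move=> /is_derive_mx hF /is_derive_mx hG.
have hp i := is_deriveM (hF 0 i) (hG 0 i).
rewrite (_ : (fun s => _) =
  (fun s => F s 0 0) * (fun s => G s 0 0) +
  (fun s => F s 0 1) * (fun s => G s 0 1) -
  (fun s => F s 0 2) * (fun s => G s 0 2) -
  (fun s => F s 0 3) * (fun s => G s 0 3)); last by apply/funext.
apply: is_derive_eq
  (is_deriveB (is_deriveB (is_deriveD (hp 0) (hp 1)) (hp 2)) (hp 3)) _.
by rewrite /dot /GRing.scale /=; ring.
Qed.

(** Formulas such as the one for [z_u] are known only on [I]; since [I] is open they hold near [x],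
    so they may be differentiated once more. *)
Lemma is_derive_eq_on (R : realType) (V : normedModType R) (I : set R)
    (h k : R -> V) (d : V) (x : R) :
  open I -> I x -> (forall s, I s -> h s = k s) ->
  is_derive x 1 h d -> is_derive x 1 k d.
Proof.
move=> oI Ix hk; apply: near_eq_is_derive.
by near=> s; apply: hk; near: s; apply: open_nbhs_nbhs.
Unshelve. all: by end_near. Qed.

Lemma is_derive_derive1 (R : realType) (V : normedModType R) (h : R -> V)
    (d : V) (x : R) :
  is_derive x 1 h d -> derive1 h x = d.
Proof. by move=> hd; rewrite derive1E derive_val. Qed.

Lemma smooth_is_derive (R : realType) (V : normedModType R) (I : set R)
    (h : R -> V) (k : nat) (x : R) :
  smooth_on I h -> I x -> is_derive x 1 (derive1n k h) (derive1n k.+1 h x).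
Proof.
by move=> hs Ix; rewrite derive1nS derive1E; apply/derivableP; exact: hs.
Qed.

(** A nonpositive product would put 0 between [h x] and [h y]; the intermediate value theorem then
    yields a zero between [x] and [y], hence in [I]. *)
Lemma interval_same_sign (R : realType) (I : set R) (h : R -> R) :
  is_interval I -> (forall x, I x -> derivable h x 1) ->
  (forall x, I x -> h x != 0) ->
  forall x y, I x -> I y -> 0 < h x * h y.
Proof.
move=> iI dh h0.
suff le_case x y : I x -> I y -> x <= y -> 0 < h x * h y.
  move=> x y Ix Iy; have [xy|/ltW yx] := leP x y; first exact: le_case.
  by rewrite mulrC; apply: le_case.
move=> Ix Iy xy; rewrite ltNge; apply/negP => hxy.
have Isub z : z \in `[x, y] -> I z.
  by rewrite in_itv /= => /andP[xz zy]; apply: (iI x y) => //; rewrite xz zy.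
have [//|||z /Isub Iz hz] := @IVT R h x y 0.
- by apply: derivable_within_continuous => z /Isub; exact: dh.
- rewrite ge_min le_max; have [hx|hx|hx] := ltgtP (h x) 0.
  + by rewrite /= -(nmulr_rle0 _ hx) hxy.
  + by rewrite /= andbT -(pmulr_rle0 _ hx) hxy.
  + by move: (h0 _ Ix); rewrite hx eqxx.
- by move: (h0 _ Iz); rewrite hz eqxx.
Qed.

(** Two values of [h] can differ only by sign, and a nowhere zero derivable function cannot change
    sign on an interval. *)
Lemma interval_cst_of_sqr (R : realType) (I : set R) (h : R -> R) (k : R) :
  is_interval I -> (forall x, I x -> derivable h x 1) -> k != 0 ->
  (forall x, I x -> h x ^+ 2 = k) ->
  forall x y, I x -> I y -> h x = h y.
Proof.
move=> iI dh k0 hk x y Ix Iy.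
have h0 z : I z -> h z != 0 by move=> Iz; rewrite -sqrf_eq0 hk.
have := interval_same_sign iI dh h0 Ix Iy.
have /eqP : h x ^+ 2 = h y ^+ 2 by rewrite !hk.
rewrite eqf_sqr => /orP[/eqP//|/eqP ->].
by rewrite mulNr -expr2 oppr_gt0 ltNge sqr_ge0.
Qed.

Lemma interval_cst_of_derive0 (R : realType) (I : set R) (h : R -> R) :
  is_interval I -> (forall x, I x -> is_derive x 1 h 0) ->
  forall x y, I x -> I y -> h x = h y.
Proof.
move=> iI dh.
suff le_case x y : I x -> I y -> x <= y -> h x = h y.
  move=> x y Ix Iy; have [xy|/ltW yx] := leP x y; first exact: le_case.
  by apply/esym; apply: le_case.
move=> Ix Iy xy.
have Isub z : z \in `[x, y] -> I z.
  by rewrite in_itv /= => /andP[xz zy]; apply: (iI x y) => //; rewrite xz zy.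
have [||z _] := @MVT_segment R h (fun=> 0) x y xy.
- by move=> z zxy; apply/dh/Isub; apply: subset_itv_oo_cc.
- by apply: derivable_within_continuous => z /Isub /dh [].
by rewrite mul0r => /eqP; rewrite subr_eq0 => /eqP.
Qed.

(** Serves to differentiate relations valid along [I] or [J], such as [f'^2 - g'^2 = 1] or
    [dot l l = 1]. *)
Lemma is_derive_cst_on (R : realType) (V : normedModType R) (I : set R)
    (h : R -> V) (k d : V) (x : R) :
  open I -> I x -> (forall s, I s -> h s = k) -> is_derive x 1 h d -> d = 0.
Proof.
move=> oI Ix hk /(is_derive_eq_on oI Ix hk) hd.
by rewrite -(is_derive_derive1 hd) derive1_cst.
Qed.

Lemma is_derive_lincomb (R : realType) (m k : nat) (p q : R -> R)
    (A B : 'M[R]_(m, k)) (dp dq x : R) :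
  is_derive x 1 p dp -> is_derive x 1 q dq ->
  is_derive x 1 (fun s => p s *: A + q s *: B) (dp *: A + dq *: B).
Proof.
move=> hp hq.
have hA := is_derive_scale_mx hp (is_derive_cst A x 1).
have hB := is_derive_scale_mx hq (is_derive_cst B x 1).
by apply: is_derive_eq (is_deriveD hA hB) _; rewrite !scaler0 !addr0.
Qed.

(** * The inner product *)

Section Dot.
Variable R : realType.
Implicit Types (x y z : 'rV[R]_4) (k : R).

Lemma dotC x y : dot x y = dot y x.
Proof. by rewrite /dot; ring. Qed.

Lemma dotDl x y z : dot (x + y) z = dot x z + dot y z.
Proof. by rewrite /dot !mxE; ring. Qed.

Lemma dotDr x y z : dot z (x + y) = dot z x + dot z y.
Proof. by rewrite dotC dotDl !(dotC z). Qed.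

Lemma dotZl k x y : dot (k *: x) y = k * dot x y.
Proof. by rewrite /dot !mxE; ring. Qed.

Lemma dotZr k x y : dot x (k *: y) = k * dot x y.
Proof. by rewrite dotC dotZl dotC. Qed.

Lemma dotNl x y : dot (- x) y = - dot x y.
Proof. by rewrite -scaleN1r dotZl mulN1r. Qed.

Lemma dotNr x y : dot x (- y) = - dot x y.
Proof. by rewrite dotC dotNl dotC. Qed.

Definition dotE := (dotDl, dotDr, dotNl, dotNr, dotZl, dotZr).

Lemma dot_std3 x : dot x (std R 3) = - x 0 3.
Proof. by rewrite /dot /std !mxE /= !mulr0 mulr1 !addr0 subr0 sub0r. Qed.

Lemma E31_coord3 x : E31 x -> x 0 3 = 0.
Proof.
by move=> [a [b [c ->]]]; rewrite /std !mxE /= !mulr0 !addr0.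
Qed.

(** With the signature carried by a power of -1, [dot] becomes an entry of a matrix product. *)
Lemma dot_sum x y :
  dot x y = \sum_(k < 4) (-1) ^+ (1 < k)%N * (x 0 k * y 0 k).
Proof.
rewrite !big_ord_recr big_ord0 /= add0r !expr0 !expr1 !mul1r !mulN1r /dot.
by congr (_ + _ - _ - _); congr (x 0 _ * y 0 _); apply: val_inj.
Qed.

(** [M] has the frame as rows and [N] is its adjoint for the indefinite product. Orthonormality says
    [M *m N = 1]; a one-sided inverse of a square matrix is two-sided, and [w = w *m N *m M] is the
    expansion. *)
Lemma orthonormal_expansion (e : 'I_4 -> 'rV[R]_4) (eps : 'I_4 -> R) w :
  (forall i, eps i ^+ 2 = 1) ->
  (forall i j, dot (e i) (e j) = if i == j then eps i else 0) ->
  w = \sum_i (eps i * dot w (e i)) *: e i.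
Proof.
move=> eps2 eE.
pose M : 'M[R]_4 := \matrix_(i, k) e i 0 k.
pose N : 'M[R]_4 := \matrix_(k, j) (eps j * ((-1) ^+ (1 < k)%N * e j 0 k)).
have mulN x j : (x *m N) 0 j = eps j * dot x (e j).
  rewrite mxE dot_sum mulr_sumr; apply: eq_bigr => k _.
  by rewrite mxE; ring.
have rowM i : row i M = e i by apply/rowP => k; rewrite !mxE.
have MN : M *m N = 1%:M.
  apply/matrixP => i j.
  have -> : (M *m N) i j = (row i M *m N) 0 j by rewrite -row_mul [RHS]mxE.
  rewrite mulN rowM eE mxE.
  by case: eqVneq => [->|_]; rewrite ?mulr0 // -expr2 eps2.
have NM : N *m M = 1%:M by exact: mulmx1C.
rewrite -[LHS]mulmx1 -NM mulmxA mulmx_sum_row.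
by apply: eq_bigr => i _; rewrite mulN rowM.
Qed.

End Dot.

(** * Mean curvature of the meridian surface *)

Lemma is_mean_curvature_orthogonal (R : realType) (z : R -> R -> 'rV[R]_4)
    (u v r c : R) (x y xu yv : 'rV[R]_4) :
  z_u z u v = x -> z_v z u v = y -> z_uu z u v = xu -> z_vv z u v = yv ->
  r != 0 -> dot x x = 1 -> dot x y = 0 -> dot y y = - r ^+ 2 ->
  dot xu x = 0 -> dot xu y = 0 -> dot yv x = c -> dot yv y = 0 ->
  is_mean_curvature z u v (2^-1 *: (xu - r ^- 2 *: (yv - c *: x))).
Proof.
move=> zu zv zuu zvv r0 xx xy yy xux xuy yvx yvy.
(* The frame is [z_u], [z_v / r]. Neither vector mixes the two coordinates, so [z_uv] enters with
   coefficient 0 and is generalized to an arbitrary [xv]. *)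
exists (1, 0), (0, r^-1).
rewrite /lorentz_frame /second_ff /normal_part /tangent /gram_det /=.
rewrite zu zv zuu zvv; move: (z_uv z u v) => xv.
rewrite !(mul0r, mulr0, mul1r, mulr1, scale0r, scale1r, addr0, add0r).
split; first by rewrite !dotE xx xy yy; split=> //; field.
have -> : r^-1 / r = r ^- 2 by rewrite -exprVn.
rewrite !dotZl xx xy yy xux xuy yvx yvy.
rewrite !(mulr0, mul0r, mul1r, subr0, expr0n) /= !(mul0r, scale0r, addr0) subr0.
rewrite [_ / - _]mulrC mulKf ?oppr_eq0 ?sqrf_eq0 //.
by rewrite -scalerA -scalerBr.
Qed.

(* Here and below [a], [p], [q], [r], [s], [k] stand for the values of [f],
   [f'], [g'], [f''], [g''], [kappa], and [L], [T], [N], [e] for [l], [l'],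
   [n], [e_4]. *)
Lemma meridian_gram (R : realType) (L T N e : 'rV[R]_4) (a p q r s k : R) :
  dot L L = 1 -> dot T T = -1 -> dot e e = -1 -> dot L T = 0 -> dot L e = 0 ->
  dot T e = 0 -> dot L N = 0 -> dot T N = 0 -> dot N e = 0 ->
  p ^+ 2 - q ^+ 2 = 1 -> p * r = q * s ->
  let x := p *: L + q *: e in let xu := r *: L + s *: e in
  let y := a *: T in let yv := a *: (k *: N + L) in
  [/\ dot x x = 1, dot x y = 0, dot y y = - a ^+ 2
    & [/\ dot xu x = 0, dot xu y = 0, dot yv x = a * p & dot yv y = 0]].
Proof.
move=> LL TT ee LT Le Te LN TN Ne pq pr /=.
rewrite !dotE (dotC e L) (dotC e T) (dotC N L) (dotC N T).
rewrite LL TT ee LT Le Te LN TN Ne.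
split; [rewrite -[RHS]pq; ring|ring|ring|split; [|ring|ring|ring]].
transitivity (p * r - q * s); first by ring.
by rewrite pr subrr.
Qed.

Lemma meridian_mean_curvature_vector (R : realType) (L N e : 'rV[R]_4)
    (a p q r s k : R) :
  a != 0 -> q != 0 -> p ^+ 2 - q ^+ 2 = 1 -> p * r = q * s ->
  r *: L + s *: e
    - a ^- 2 *: (a *: (k *: N + L) - (a * p) *: (p *: L + q *: e)) =
  (r / q + q / a) *: (q *: L + p *: e) - (k / a) *: N.
Proof.
move=> a0 q0 pq pr.
have -> : s = p * r / q by rewrite pr mulrC mulKf.
(* Only the [L] coming from [z_vv] is multiplied by [1 = p^2 - q^2]: removing the tangential part
   [p (p L + q e)] then leaves [- q (q L + p e)], a multiple of the normal. *)
rewrite [in k *: N + L](_ : L = (p ^+ 2 - q ^+ 2) *: L); last first.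
  by rewrite pq scale1r.
by apply/rowP => i; rewrite !mxE; field; rewrite a0.
Qed.

(** [q L + p e] and [N] are orthogonal of squares -1 and 1, so [dot W W] is a difference of squares.
    When it vanishes, [W] is zero exactly when [k] is. *)
Lemma meridian_lightlike (R : realType) (L N e : 'rV[R]_4) (a p q r k : R) :
  dot L L = 1 -> dot N N = 1 -> dot e e = -1 -> dot L e = 0 -> dot L N = 0 ->
  dot N e = 0 -> a != 0 -> q != 0 -> p ^+ 2 - q ^+ 2 = 1 ->
  let W := 2^-1 *:
    ((r / q + q / a) *: (q *: L + p *: e) - (k / a) *: N) in
  (W != 0 /\ dot W W = 0) <->
  (k != 0 /\ k ^+ 2 = ((a * r + q ^+ 2) / q) ^+ 2).
Proof.
move=> LL NN ee Le LN Ne a0 q0 pq /=.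
set b := ((a * r + q ^+ 2) / q).
have -> : r / q + q / a = b / a by rewrite /b; field; rewrite a0.
set W := 2^-1 *: _.
have WW : dot W W = (k ^+ 2 - b ^+ 2) / (4 * a ^+ 2).
  rewrite /W !dotE (dotC N L) (dotC e N) (dotC e L) LL NN ee Le LN Ne.
  transitivity ((k ^+ 2 - b ^+ 2 * (p ^+ 2 - q ^+ 2)) / (4 * a ^+ 2)).
    by field.
  by rewrite pq mulr1.
have WN : dot W N = - k / (2 * a).
  by rewrite /W !dotE (dotC e N) NN LN Ne; field.
split=> [[W0 /eqP]|[k0 kb]].
  rewrite WW mulf_eq0 invr_eq0 mulf_eq0 sqrf_eq0 (negPf a0) orbF pnatr_eq0.
  rewrite orbF subr_eq0 => /eqP kb; split=> //.
  apply: contraNneq W0 => k0; move: kb; rewrite k0 expr0n /= => /esym/eqP.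
  rewrite sqrf_eq0 => /eqP b0.
  by rewrite /W k0 b0 !mul0r !scale0r subr0 scaler0.
split; last by rewrite WW kb subrr mul0r.
apply: contraNneq k0 => W0; move/eqP: WN.
rewrite W0 -(scale0r 0) dotZl mul0r eq_sym mulf_eq0 oppr_eq0 invr_eq0.
by rewrite mulf_eq0 (negPf a0) pnatr_eq0 !orbF.
Qed.

(** * Moving frame and second derivatives of the meridian surface *)

Section Meridian.
Context {R : realType} {I J : set R} {f g : R -> R} {l n : R -> 'rV[R]_4}.
Context (hM : meridian_data_Mb I J f g l) (hn : frame_normal J l n).

Local Notation z := (meridian_surface f g l).
Local Notation f' := (derive1 f).
Local Notation g' := (derive1 g).
Local Notation f'' := (derive1 (derive1 f)).
Local Notation g'' := (derive1 (derive1 g)).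
Local Notation t := (derive1 l).
Local Notation t' := (derive1 (derive1 l)).
Local Notation kappa := (spherical_curvature l n).

Lemma Mb_openI : open I. Proof. by case: hM => [[[]]]. Qed.
Lemma Mb_openJ : open J. Proof. by case: hM => [[_ []]]. Qed.

Lemma Mb_df u : I u -> is_derive u 1 f (f' u).
Proof. by case: hM => _ [hf _] _ _ _; exact: (smooth_is_derive 0 hf). Qed.

Lemma Mb_ddf u : I u -> is_derive u 1 f' (f'' u).
Proof. by case: hM => _ [hf _] _ _ _; exact: (smooth_is_derive 1 hf). Qed.

Lemma Mb_dddf u : I u -> is_derive u 1 f'' (derive1 f'' u).
Proof. by case: hM => _ [hf _] _ _ _; exact: (smooth_is_derive 2 hf). Qed.

Lemma Mb_dg u : I u -> is_derive u 1 g (g' u).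
Proof. by case: hM => _ [_ hg] _ _ _; exact: (smooth_is_derive 0 hg). Qed.

Lemma Mb_ddg u : I u -> is_derive u 1 g' (g'' u).
Proof. by case: hM => _ [_ hg] _ _ _; exact: (smooth_is_derive 1 hg). Qed.

Lemma Mb_dl v : J v -> is_derive v 1 l (t v).
Proof. by case: hM => _ _ _ hl _; exact: (smooth_is_derive 0 hl). Qed.

Lemma Mb_ddl v : J v -> is_derive v 1 t (t' v).
Proof. by case: hM => _ _ _ hl _; exact: (smooth_is_derive 1 hl). Qed.

Lemma Mb_dddl v : J v -> is_derive v 1 t' (derive1 t' v).
Proof. by case: hM => _ _ _ hl _; exact: (smooth_is_derive 2 hl). Qed.

Lemma Mb_profile u : I u ->
  [/\ f u != 0, f' u ^+ 2 - g' u ^+ 2 = 1 & 0 < g' u].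
Proof. by case: hM => _ _ h _ _; exact: h. Qed.

Lemma Mb_f'_neq0 u : I u -> f' u != 0.
Proof.
move=> /Mb_profile[_ fg _]; apply: contra_eq_neq fg => ->.
by rewrite expr0n sub0r lt_eqF // (le_lt_trans _ ltr01) // oppr_le0 sqr_ge0.
Qed.

(** Half the derivative of [f'^2 - g'^2 = 1]. *)
Lemma Mb_f'f'' u : I u -> f' u * f'' u = g' u * g'' u.
Proof.
move=> Iu.
have hf := Mb_ddf Iu.
have hg := Mb_ddg Iu.
have eq1 s : I s -> (f' * f' - g' * g') s = 1.
  by move=> /Mb_profile[_ <- _]; rewrite !expr2.
have := is_derive_cst_on Mb_openI Iu eq1
  (is_deriveB (is_deriveM hf hf) (is_deriveM hg hg)).
rewrite /GRing.scale /=.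
by move: (f' u * f'' u) (g' u * g'' u) => p q; lra.
Qed.

(** Differentiating [dot l l = 1] makes [t] orthogonal to [l], and differentiating the vanishing
    last coordinate of [l] keeps [t] in [E31]. The three zero coordinates give orthogonality to
    [e_4]. *)
Lemma Mb_frame v : J v ->
  [/\ dot (l v) (l v) = 1, dot (t v) (t v) = -1, dot (n v) (n v) = 1,
      [/\ dot (l v) (t v) = 0, dot (l v) (n v) = 0 & dot (t v) (n v) = 0]
    & [/\ l v 0 3 = 0, t v 0 3 = 0 & n v 0 3 = 0]].
Proof.
move=> Jv; case: hM => _ _ _ _ lS; case: hn => _ /(_ _ Jv)[nE nn ln tn].
have [[lE ll] tt] := lS _ Jv.
have hl := Mb_dl Jv.
have ll1 s : J s -> dot (l s) (l s) = 1 by move=> /lS[[]].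
have l30 s : J s -> l s 0 3 = 0 by move=> /lS[[/E31_coord3]].
have lt0 := is_derive_cst_on Mb_openJ Jv ll1 (is_derive_dot hl hl).
split=> //; split=> //; [|exact: l30| |exact: E31_coord3].
- by move: lt0; rewrite (dotC (t v)); lra.
- have /is_derive_mx/(_ 0 3) := hl; exact: is_derive_cst_on Mb_openJ Jv l30.
Qed.

(** The components of [t'] along [l], [t] and [e_4] come from differentiating [dot t l = 0],
    [dot t t = -1] and the zero last coordinate of [t]; the one along [n] is [kappa] by
    definition. *)
Lemma Mb_frenet v : J v -> t' v = kappa v *: n v + l v.
Proof.
move=> Jv.
have [ll tt nn [lt ln tn] [l3 t3 n3]] := Mb_frame Jv.
have hl := Mb_dl Jv.
have ht := Mb_ddl Jv.
have tl s : J s -> dot (t s) (l s) = 0.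
  by move=> /Mb_frame[_ _ _ [e _ _] _]; rewrite dotC.
have tts s : J s -> dot (t s) (t s) = -1 by move=> /Mb_frame[].
have t3s s : J s -> t s 0 3 = 0 by move=> /Mb_frame[_ _ _ _ []].
have t'l : dot (t' v) (l v) = 1.
  have := is_derive_cst_on Mb_openJ Jv tl (is_derive_dot ht hl).
  by rewrite tt; move: (dot _ _) => x; lra.
have t't : dot (t' v) (t v) = 0.
  have := is_derive_cst_on Mb_openJ Jv tts (is_derive_dot ht ht).
  by rewrite (dotC (t v)); move: (dot _ _) => x; lra.
have t'3 : t' v 0 3 = 0.
  have /is_derive_mx/(_ 0 3) := ht; exact: is_derive_cst_on Mb_openJ Jv t3s.
(* The frame is [l, t, n, e_4], with squares 1, -1, 1, -1. *)
have := @orthonormal_expansion R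
  (fun i : 'I_4 => nth 0 [:: l v; t v; n v; std R 3] i)
  (fun i : 'I_4 => nth 0 [:: 1; -1; 1; -1] i) (t' v).
rewrite !big_ord_recr big_ord0 /= => ->.
- rewrite t'l t't dot_std3 t'3 oppr0 !mulr0 !scale0r !addr0 add0r mul1r scale1r.
  by rewrite mul1r addrC.
- by case=> [[|[|[|[|]]]]] //= _; rewrite ?expr1n ?sqrrN ?expr1n.
- have s33 : std R 3 0 3 = 1 by rewrite mxE.
  case=> [[|[|[|[|]]]]] //= ?; case=> [[|[|[|[|]]]]] //= ?;
  rewrite ?dot_std3 ?(dotC (std R 3)) ?dot_std3 ?(dotC (n v) (t v))
    ?(dotC _ (l v)) ?l3 ?t3 ?n3 ?s33 ?oppr0 //.
Qed.

Lemma z_uE u v : I u -> z_u z u v = f' u *: l v + g' u *: std R 3.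
Proof.
move=> Iu.
have hf := Mb_df Iu.
have hg := Mb_dg Iu.
exact: is_derive_derive1 (is_derive_lincomb (l v) (std R 3) hf hg).
Qed.

Lemma z_uuE u v : I u -> z_uu z u v = f'' u *: l v + g'' u *: std R 3.
Proof.
move=> Iu; have zu s : I s -> f' s *: l v + g' s *: std R 3 = z_u z s v.
  by move=> /z_uE ->.
apply/is_derive_derive1/(is_derive_eq_on Mb_openI Iu zu).
have hf := Mb_ddf Iu.
have hg := Mb_ddg Iu.
exact: (is_derive_lincomb (l v) (std R 3) hf hg).
Qed.

Lemma z_vE u v : J v -> z_v z u v = f u *: t v.
Proof.
move=> Jv; have hl := Mb_dl Jv.
have hz := is_deriveD (is_deriveZ (f u) hl)
  (is_derive_cst (g u *: std R 3) v 1).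
by rewrite [LHS](is_derive_derive1 hz) addr0.
Qed.

Lemma z_vvE u v : J v -> z_vv z u v = f u *: (kappa v *: n v + l v).
Proof.
move=> Jv; rewrite -(Mb_frenet Jv).
have zv s : J s -> f u *: t s = z_v z u s by move=> /z_vE ->.
apply/is_derive_derive1/(is_derive_eq_on Mb_openJ Jv zv).
by apply: is_deriveZ; exact: Mb_ddl Jv.
Qed.

Lemma mean_curvatureE u v : I u -> J v ->
  is_mean_curvature z u v
    (2^-1 *: ((f'' u / g' u + g' u / f u) *: (g' u *: l v + f' u *: std R 3)
              - (kappa v / f u) *: n v)).
Proof.
move=> Iu Jv.
have [f0 fg g0] := Mb_profile Iu.
have g'0 := lt0r_neq0 g0.
have [ll tt nn [lt ln tn] [l3 t3 n3]] := Mb_frame Jv.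
have e30 (w : 'rV[R]_4) : w 0 3 = 0 -> dot w (std R 3) = 0.
  by move=> w3; rewrite dot_std3 w3 oppr0.
have ee : dot (std R 3) (std R 3) = -1 by rewrite dot_std3 mxE.
have pr := Mb_f'f'' Iu.
have [uu uv vv [uuu uuv vvu vvv]] := meridian_gram (f u) (kappa v) ll tt ee
  lt (e30 _ l3) (e30 _ t3) ln tn (e30 _ n3) fg pr.
have vec := meridian_mean_curvature_vector (l v) (n v) (std R 3) (kappa v)
  f0 g'0 fg pr.
rewrite -[X in 2^-1 *: X]vec.
exact: (is_mean_curvature_orthogonal (z_uE v Iu) (z_vE u Jv) (z_uuE v Iu)
  (z_vvE u Jv) f0 uu uv vv uuu uuv vvu vvv).
Qed.

(** Uniqueness of the mean curvature vector replaces the vector given by [quasi_minimal] with the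
    explicit one, to which the lightlike criterion applies. *)
Lemma meridian_quasi_minimalP :
  quasi_minimal z I J <->
  forall u v, I u -> J v -> kappa v != 0 /\
    kappa v ^+ 2 = ((f u * f'' u + g' u ^+ 2) / g' u) ^+ 2.
Proof.
have lightlikeP u v : I u -> J v -> let H := 2^-1 *:
    ((f'' u / g' u + g' u / f u) *: (g' u *: l v + f' u *: std R 3)
      - (kappa v / f u) *: n v) in
    (H != 0 /\ dot H H = 0) <-> (kappa v != 0 /\
    kappa v ^+ 2 = ((f u * f'' u + g' u ^+ 2) / g' u) ^+ 2).
  move=> Iu Jv; have [f0 fg g0] := Mb_profile Iu.
  have [ll tt nn [lt ln tn] [l3 t3 n3]] := Mb_frame Jv.
  apply: (meridian_lightlike (f'' u) (kappa v) ll nn _ _ ln _ f0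
    (lt0r_neq0 g0) fg); rewrite dot_std3 ?l3 ?n3 ?oppr0 //.
  by rewrite mxE.
split=> [qm u v Iu Jv|h u v Iu Jv].
  apply/(lightlikeP u v Iu Jv); have [H [mH H0 HH]] := qm u v Iu Jv.
  by rewrite /= -(mean_curvature_unique mH (mean_curvatureE Iu Jv)).
have /(lightlikeP u v Iu Jv)[H0 HH] := h u v Iu Jv.
by eexists; split; [exact: mean_curvatureE Iu Jv| |].
Qed.

(** * Separation of variables and integration *)

Local Notation ratio := (fun u => (f u * f'' u + g' u ^+ 2) / g' u).

(** Product rule, with [g'' = f' f'' / g']. Where [ratio] is constant, the right-hand side is a
    multiple of [f'] and can be integrated. *)
Lemma is_derive_fg' u : I u ->
  is_derive u 1 (f * g') (f' u * ratio u).
Proof.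
move=> Iu; have [f0 fg g0] := Mb_profile Iu; have g'0 := lt0r_neq0 g0.
apply: is_derive_eq (is_deriveM (Mb_df Iu) (Mb_ddg Iu)) _.
have := Mb_f'f'' Iu; rewrite /GRing.scale /=.
move: (f u) (f' u) (f'' u) (g' u) (g'' u) g'0 => a p r q s q0 pr.
have -> : s = p * r / q by rewrite pr mulrC mulKf.
by field.
Qed.

Lemma derivable_ratio u : I u -> derivable ratio u 1.
Proof.
move=> Iu; have [f0 fg g0] := Mb_profile Iu; have g'0 := lt0r_neq0 g0.
have [df _] := Mb_df Iu; have [dddf _] := Mb_dddf Iu.
have [ddg _] := Mb_ddg Iu.
rewrite (_ : ratio = (f * f'' + g' * g') * (fun s => (g' s)^-1)).
  have dnum := derivableD (derivableM df dddf) (derivableM ddg ddg).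
  exact: (derivableM dnum (derivableV g'0 ddg)).
by apply/funext => s; rewrite expr2.
Qed.

Lemma derivable_kappa v : J v -> derivable kappa v 1.
Proof.
move=> Jv; have [hn1 _] := hn.
by have [] := is_derive_dot (Mb_dddl Jv) (smooth_is_derive 0 hn1 Jv).
Qed.

Lemma quasi_minimal_ode : quasi_minimal z I J ->
  exists a : R,
    [/\ a != 0, forall v, J v -> kappa v = a
      & exists (c : R) (s1 s2 : bool), forall u, I u ->
          f' u = phi s1 s2 a c (f u) /\ g' u = Num.sqrt (f' u ^+ 2 - 1)].
Proof.
move=> /meridian_quasi_minimalP qm.
have [[[_ iI [u0 Iu0]] [_ iJ [v0 Jv0]]] _ _ _ _] := hM.
have [a0 aB0] := qm u0 v0 Iu0 Jv0.
(* Freezing [u = u0] makes [kappa^2] constant on [J]; freezing [v = v0] makes [ratio^2] constant on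
   [I], with the same value [a^2]. *)
pose a := kappa v0; pose b := ratio u0; have a20 : a ^+ 2 != 0 by rewrite sqrf_eq0.
exists a; split=> // [v Jv|].
  apply: (interval_cst_of_sqr iJ derivable_kappa a20) => // w Jw.
  by have [_ ->] := qm u0 w Iu0 Jw; rewrite /a aB0.
have Bb u : I u -> ratio u = b.
  move=> Iu; apply: (interval_cst_of_sqr iI derivable_ratio a20) => // w Iw.
  by have [_ ->] := qm w v0 Iw Jv0.
have [s2 bE] : exists s2 : bool, b = (-1) ^+ s2 * a.
  have /eqP := aB0; rewrite eqf_sqr => /orP[]/eqP ab.
    by exists false; rewrite mul1r /a ab.
  by exists true; rewrite mulN1r /a ab opprK.
(* The integration constant: [f g' - b f] has zero derivative on [I]. *)
pose c := f u0 * g' u0 - b * f u0.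
have fgE u : I u -> f u * g' u = c + b * f u.
  move=> Iu; have : (f * g' - b *: f) u = (f * g' - b *: f) u0.
    apply: (interval_cst_of_derive0 iI) => // w Iw.
    apply: is_derive_eq
      (is_deriveB (is_derive_fg' Iw) (is_deriveZ b (Mb_df Iw))) _.
    by rewrite Bb // mulrC subrr.
  by rewrite /c => /(canRL (subrK _)).
(* The factor [t^-1] in [phi] carries the sign of [f], so the outer sign is that of [f f'], constant
   because [f f'] never vanishes. *)
pose w := f * f'.
have w0 u : I u -> w u != 0.
  by move=> Iu; rewrite mulf_neq0 ?Mb_f'_neq0 //; case: (Mb_profile Iu).
have dw u : I u -> derivable w u 1.
  by move=> Iu; have [] := is_deriveM (Mb_df Iu) (Mb_ddf Iu).
exists c, (w u0 < 0), s2 => u Iu; have [f0 fg g0] := Mb_profile Iu.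
split; last first.
  by rewrite -fg opprB addrC subrK sqrtr_sqr gtr0_norm.
have w0E : (w u0 < 0) = (w u < 0).
  have := interval_same_sign iI dw w0 Iu Iu0.
  have [wu|wu|/eqP] := ltgtP (w u) 0; last by rewrite (negPf (w0 _ Iu)).
    by rewrite nmulr_rgt0 // => ->.
  by rewrite pmulr_rgt0 // => /lt_gtF.
rewrite /phi [_ * (a * _)]mulrA -bE -fgE //.
(* The radicand is thus a perfect square, its root is the absolute value of [w u], and the sign
   restores [w u = f u * f' u]. *)
have -> : (f u * g' u) ^+ 2 + f u ^+ 2 = w u ^+ 2.
  transitivity (f u ^+ 2 * (g' u ^+ 2 + (f' u ^+ 2 - g' u ^+ 2))).
    by rewrite fg; ring.
  by rewrite (_ : w u = f u * f' u) //; ring.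
by rewrite sqrtr_sqr w0E mulrCA -realEsign ?num_real // [RHS]mulKf.
Qed.

(** Squaring the equation for [f'] removes the root and the outer sign, and [f'^2 = 1 + g'^2]
    reduces it to [(f g')^2 = (c + b f)^2], which is then differentiated. *)
Lemma ode_quasi_minimal (a c : R) (s1 s2 : bool) :
  a != 0 -> (forall v, J v -> kappa v = a) ->
  (forall u, I u -> f' u = phi s1 s2 a c (f u)) ->
  quasi_minimal z I J.
Proof.
move=> a0 ka ode; apply/meridian_quasi_minimalP => u v Iu Jv; rewrite ka //.
split=> //.
pose b := (-1) ^+ s2 * a.
have b2 : b ^+ 2 = a ^+ 2 by rewrite exprMn sqrr_sign mul1r.
have fgE s : I s -> (f s * g' s) ^+ 2 = (c + b * f s) ^+ 2.
  move=> Is; have [f0 fg g0] := Mb_profile Is.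
  have : (f s * f' s) ^+ 2 = (c + b * f s) ^+ 2 + f s ^+ 2.
    rewrite ode // /phi [_ * (a * _)]mulrA mulrCA mulVKf // exprMn sqrr_sign.
    by rewrite mul1r sqr_sqrtr // addr_ge0 ?sqr_ge0.
  move=> e; apply: (addIr (f s ^+ 2)); rewrite -e.
  transitivity (f s ^+ 2 * (g' s ^+ 2 + (f' s ^+ 2 - g' s ^+ 2))).
    by rewrite fg; ring.
  by ring.
(* Differentiating the squared relation [fgE] gives the square of [ratio],
   whatever the sign of [c + b * f]. *)
have dF := is_derive_fg' Iu.
have dG : is_derive u 1 (cst c + b *: f) (b * f' u).
  by apply: is_derive_eq
    (is_deriveD (is_derive_cst c u 1) (is_deriveZ b (Mb_df Iu))) _;
    rewrite add0r.
have eq0 s : I s -> ((f * g') * (f * g') -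
    (cst c + b *: f) * (cst c + b *: f)) s = 0.
  by move=> Is; apply/eqP; rewrite subr_eq0 -!expr2; apply/eqP; exact: fgE.
have := is_derive_cst_on Mb_openI Iu eq0
  (is_deriveB (is_deriveM dF dF) (is_deriveM dG dG)).
have [f0 fg g0] := Mb_profile Iu; have FG := fgE _ Iu.
have F0 : f u * g' u != 0 by rewrite mulf_neq0 // lt0r_neq0.
have p0 := Mb_f'_neq0 Iu; rewrite -b2.
change ((f * g') u) with (f u * g' u).
change ((cst c + b *: f) u) with (c + b * f u).
move: (f u * g' u) (c + b * f u) (f' u) ((_ + _) / _) F0 FG p0.
move=> F G p y F0 FG p0.
rewrite /GRing.scale /= => e.
(* The differentiated relation divided by [2 f']. Squaring it and cancelling [F^2 = G^2], which is
   nonzero, leaves [y^2 = b^2]. *)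
have Fy : F * y = G * b.
  apply: (mulfI p0); apply/eqP; rewrite -subr_eq0; apply/eqP; lra.
have F20 : F ^+ 2 != 0 by rewrite sqrf_eq0.
by apply: (mulfI F20); rewrite -[RHS]exprMn Fy [RHS]exprMn FG.
Qed.

End Meridian.

Theorem theorem6 (R : realType) (I J : set R) (f g : R -> R)
    (l n : R -> 'rV[R]_4)
    (hM : meridian_data_Mb I J f g l) (hn : frame_normal J l n) :
  quasi_minimal (meridian_surface f g l) I J <->
  exists a : R,
    [/\ a != 0,
        forall v, J v -> spherical_curvature l n v = a
      & exists (c : R) (s1 s2 : bool), forall u, I u ->
          derive1 f u = phi s1 s2 a c (f u) /\
          derive1 g u = Num.sqrt (derive1 f u ^+ 2 - 1)].
Proof.
split=> [|[a [a0 ka [c [s1 [s2 ode]]]]]]; first exact: quasi_minimal_ode.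
have ode1 u Iu := (ode u Iu).1.
exact: (ode_quasi_minimal hM hn a0 ka ode1).
Qed.
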